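(* Let $\alpha=1.763\ldots$ denote the solution to $x=\exp(1/x)$. Let $0<\zeta<1$. Let $G$ be a triangle-free graph on $n$ vertices having maximum degree $\Delta$, let $k$ be an integer with $k\ge\max\{(1+\zeta)\alpha\Delta,\ 288\ln(96n^3/\zeta)/\zeta^2\}$, and let $X_0$ be any $k$-coloring of $G$. Then for every $\delta>0$, after $T\ge 6n\lceil\ln(32n)\rceil\lceil\ln(1/\delta)\rceil/\zeta$ steps of the Glauber dynamics, $$\|X_T-\pi\|_{\mathrm{TV}}\le\delta.$$
   Context: $G=(V,E)$ is a finite simple graph. The state space is $\Omega=[k]^V$ with $[k]=\{1,\dots,k\}$; elements of $\Omega$ are called $k$-colorings (not necessarily proper). $\pi$ is the uniform distribution over proper $k$-colorings of $G$, viewed as a distribution on $\Omega$. The (heat-bath) Glauber dynamics is the Markov chain on $\Omega$ whose transition $X_t\to X_{t+1}$ is: choose $v$ uniformly at random from $V$; set $X_{t+1}(w)=X_t(w)$ for all $w\ne v$; choose $X_{t+1}(v)$ uniformly at random from $[k]\setminus X_{t+1}(N(v))$, where $N(v)$ is the set of neighbors of $v$. $\|\mu-\nu\|_{\mathrm{TV}}=\frac12\sum_{x}|\mu(x)-\nu(x)|$, and $\|X_T-\pi\|_{\mathrm{TV}}$ refers to the distribution of $X_T$. *)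

(* Defs.v *)
From mathcomp Require Import all_boot all_order all_algebra.
From mathcomp Require Import reals.

Set Implicit Arguments.
Unset Strict Implicit.
Unset Printing Implicit Defensive.

Import Order.TTheory GRing.Theory Num.Theory.
Local Open Scope ring_scope.

Section Graph.
Variables (V : finType) (e : rel V).

Definition simple_graph : Prop := symmetric e /\ irreflexive e.

Definition triangle_free : Prop := forall x y z, ~~ [&& e x y, e y z & e z x].

Definition neighbors (v : V) : {set V} := [set w | e v w].

Definition max_degree : nat := (\max_(v : V) #|neighbors v|)%N.

End Graph.

Section Colorings.
Variables (V : finType) (e : rel V) (k : nat).

(* Not necessarily proper. *)
Definition coloring := {ffun V -> 'I_k}.

Definition proper (X : coloring) : bool :=
  [forall v, forall w, e v w ==> (X v != X w)].

(* The heat-bath rule refers to the colors of N(v) after the step; since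
   v \notin N(v), these are the colors before the step. *)
Definition available (X : coloring) (v : V) : {set 'I_k} :=
  ~: [set X w | w in neighbors e v].

Definition agree_off (v : V) (X Y : coloring) : bool :=
  [forall w, (w != v) ==> (Y w == X w)].

Variable R : realType.

Definition uniform_proper (X : coloring) : R :=
  if proper X then #|[set Y : coloring | proper Y]|%:R^-1 else 0.

(* Probability of moving from X to Y, given that v is the selected vertex. *)
Definition heat_bath (v : V) (X Y : coloring) : R :=
  if agree_off v X Y && (Y v \in available X v)
  then #|available X v|%:R^-1 else 0.

Definition glauber (X Y : coloring) : R :=
  #|V|%:R^-1 * \sum_(v : V) heat_bath v X Y.

(* glauber_law X0 t is the distribution of X_t for the chain started at X0. *)
Fixpoint glauber_law (X0 : coloring) (t : nat) (Y : coloring) : R :=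
  match t with
  | 0%N => (Y == X0)%:R
  | s.+1 => \sum_(X : coloring) glauber_law X0 s X * glauber X Y
  end.

End Colorings.

Definition tv_dist (R : realType) (S : finType) (mu nu : S -> R) : R :=
  2^-1 * \sum_(x : S) `|mu x - nu x|.

(* Main.v *)
Require Import Defs.
From mathcomp Require Import all_boot all_order all_algebra.
From mathcomp Require Import reals sequences exp.
From mathcomp Require Import ring lra.

(* Run the chain X_t together with a stationary copy Y_t, choosing the same vertex v
   in both and coupling the two new colors maximally. The colors of v then disagree
   with probability at most d / |A_Y(v)|, where d is the number of neighbors of v at
   which X_t and Y_t disagree and A_Y(v) is the set of colors available at v in Y_t.
   So the expected Hamming distance contracts by a factor 1 - zeta / (6 n) as soon as
   every A_Y(v) has at least (1 + zeta / 5) Delta elements, and only the stationary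
   copy needs this property.

   Since G is triangle-free, N(v) is independent, so under the stationary distribution
   the colors of N(v) are independent given the colors elsewhere. Convexity of exp
   bounds the conditional mean of |A_Y(v)| below by about k exp (- Delta / k), which
   exceeds (1 + zeta / 5) Delta by a constant times zeta k because k >= (1 + zeta)
   alpha Delta and exp (- 1 / alpha) = 1 / alpha. An exponential moment bound for
   |A_Y(v)| makes small available sets unlikely. This yields total variation distance
   at most 1/8 after about 6 n ln(32 n) / zeta steps from any initial state, and
   iterating the resulting contraction gives the rate in delta. *)

Set Implicit Arguments.
Unset Strict Implicit.
Unset Printing Implicit Defensive.

Import Order.TTheory GRing.Theory Num.Theory.
Local Open Scope ring_scope.

Lemma sum_mul_eq (R : pzRingType) (T : finType) (f : T -> R) (a : T) :
  \sum_x f x * (x == a)%:R = f a.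
Proof.
rewrite (bigD1 a) //= eqxx mulr1 big1 ?addr0 // => i /negPf ->.
by rewrite mulr0.
Qed.

(** * The Glauber dynamics and its stationary distribution *)

Section Dynamics.
Variables (V : finType) (e : rel V) (k : nat) (R : realType).
Implicit Types (X Y Z : coloring V k) (v w : V) (c : 'I_k).

Definition recolor X v c : coloring V k := [ffun w => if w == v then c else X w].

Lemma recolorE X v c w : recolor X v c w = if w == v then c else X w.
Proof. by rewrite ffunE. Qed.

Lemma eq_recolor X Y v c :
  (Y == recolor X v c) = agree_off v X Y && (Y v == c).
Proof.
apply/eqP/andP => [->|[/forallP H /eqP <-]].
  split; last by rewrite recolorE eqxx.
  by apply/forallP => w; apply/implyP => /negPf ne; rewrite recolorE ne.
apply/ffunP => w; rewrite recolorE; case: eqP => [->//|/eqP ne].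
by have /implyP/(_ ne)/eqP := H w.
Qed.

(** A heat-bath step is an average of point masses over the available colors. This form turns sums
    over colorings into sums over colors. *)
Lemma heat_bathE v X Y :
  heat_bath e R v X Y =
  #|available e X v|%:R^-1 * \sum_(c in available e X v) (Y == recolor X v c)%:R.
Proof.
rewrite /heat_bath; under eq_bigr => c _ do rewrite eq_recolor.
case: (boolP (agree_off v X Y)) => /= a; last by rewrite big1 ?mulr0.
case: (boolP (Y v \in available e X v)) => m.
  rewrite (bigD1 (Y v)) //= eqxx big1 ?addr0 ?mulr1 // => c /andP[_].
  by rewrite eq_sym => /negPf ->.
rewrite big1 ?mulr0 // => c cA; case: eqP => // E.
by rewrite E cA in m.
Qed.

Lemma sum_heat_bath v X (f : coloring V k -> R) :
  \sum_Y heat_bath e R v X Y * f Y =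
  #|available e X v|%:R^-1 * \sum_(c in available e X v) f (recolor X v c).
Proof.
under eq_bigr => Y _ do rewrite heat_bathE -mulrA mulr_suml.
rewrite -mulr_sumr exchange_big /=; congr (_ * _).
apply: eq_bigr => c _.
under eq_bigr => Y _ do rewrite mulrC.
exact: sum_mul_eq.
Qed.

Lemma heat_bath_ge0 v X Y : 0 <= heat_bath e R v X Y.
Proof. by rewrite /heat_bath; case: ifP => // _; rewrite invr_ge0 ler0n. Qed.

Lemma card_available X v : (k <= #|available e X v| + max_degree e)%N.
Proof.
rewrite /available cardsCs setCK card_ord.
have h : (#|[set X w | w in neighbors e v]| <= max_degree e)%N.
  apply: leq_trans (leq_imset_card _ _) _.
  by rewrite /max_degree; apply: (leq_bigmax v).
by apply: leq_trans (leq_add (leqnn _) h); rewrite addnC -leq_subLR.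
Qed.

Hypothesis hdeg : (max_degree e < k)%N.

Lemma available_gt0 X v : (0 < #|available e X v|)%N.
Proof.
have := leq_trans hdeg (card_available X v).
by rewrite -{1}[max_degree e]add0n ltn_add2r.
Qed.

Lemma heat_bath_sum1 v X : \sum_Y heat_bath e R v X Y = 1.
Proof.
under eq_bigr => Y _ do rewrite -[heat_bath _ _ _ _ _]mulr1.
rewrite sum_heat_bath sumr_const mulVf //.
by rewrite pnatr_eq0 -lt0n available_gt0.
Qed.

Hypothesis hsimple : simple_graph e.

Lemma available_recolor X v w c : ~~ e v w ->
  available e (recolor X w c) v = available e X v.
Proof.
move=> nvw; rewrite /available; congr (~: _).
apply: eq_in_imset => u; rewrite inE recolorE => vu.
by case: eqP vu nvw => // -> ->.
Qed.

Lemma proper_recolor X v c : Defs.proper e X -> c \in available e X v ->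
  Defs.proper e (recolor X v c).
Proof.
case: hsimple => sym irr.
move=> /forallP pX; rewrite inE => /imsetP cA.
apply/forallP => x; apply/forallP => y; apply/implyP => exy.
rewrite !recolorE; case: (x =P v) => [xv|xv]; case: (y =P v) => [yv|yv].
- by move: exy; rewrite xv yv irr.
- apply/eqP => E; apply: cA; exists y => //.
  by rewrite inE -xv.
- apply/eqP => E; apply: cA; exists x => //.
  by rewrite inE -yv sym.
- by have /forallP/(_ y)/implyP/(_ exy) := pX x.
Qed.

Lemma proper_available X v : Defs.proper e X -> X v \in available e X v.
Proof.
move=> /forallP pX; rewrite inE; apply/imsetP => -[w]; rewrite inE => evw E.
by have /forallP/(_ w)/implyP/(_ evw) := pX v; rewrite E eqxx.
Qed.

(** Greedy coloring along [enum V]: a vertex has an available color whatever its neighbors carry.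
    [X] supplies the coloring at which the induction starts. *)
Lemma exists_proper X : exists Y, Defs.proper e Y.
Proof.
case: (hsimple) => sym irr.
suff [Y HY] : exists Y, forall x y, x \in enum V -> y \in enum V ->
    e x y -> Y x != Y y.
  exists Y; apply/forallP => x; apply/forallP => y; apply/implyP.
  by apply: HY; rewrite mem_enum.
elim: (enum V) => [|v s [Y HY]]; first by exists X.
have /card_gt0P[c cA] := available_gt0 Y v.
exists (recolor Y v c) => x y xs ys exy; rewrite !recolorE.
have nc u : e v u -> c != Y u.
  by move=> vu; apply: contraTneq cA => ->; rewrite inE negbK imset_f // inE.
case: (x =P v) => [xv|xv]; case: (y =P v) => [yv|yv].
- by move: exy; rewrite xv yv irr.
- by apply: nc; rewrite -xv.
- by rewrite eq_sym; apply: nc; rewrite -yv sym.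
- move: xs ys; rewrite !inE => /orP[/eqP//|xs] /orP[/eqP//|ys].
  exact: HY.
Qed.

Notation pi := (@uniform_proper V e k R).

Lemma uniform_proper_ge0 X : 0 <= pi X.
Proof. by rewrite /uniform_proper; case: ifP => // _; rewrite invr_ge0 ler0n. Qed.

Lemma sum_uniform_proper X : \sum_Y pi Y = 1.
Proof.
rewrite /uniform_proper -big_mkcond /= sumr_const.
have E : #|Defs.proper (k := k) e| = #|[set Y : coloring V k | Defs.proper e Y]|.
  by rewrite cardsE.
rewrite -E -[LHS]mulr_natr mulVf // pnatr_eq0 -lt0n.
by have [Y pY] := exists_proper X; apply/card_gt0P; exists Y.
Qed.

(** Detailed balance. A move at [v] from a proper coloring ends in a proper coloring and leaves the
    available set at [v] unchanged, so both directions have the same weight. *)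
Lemma heat_bath_reversible v X Y :
  pi X * heat_bath e R v X Y = pi Y * heat_bath e R v Y X.
Proof.
(* It suffices to treat a nonzero left side: applied in both directions, this leaves only the case
   where both sides vanish. *)
suff H X1 Y1 : pi X1 * heat_bath e R v X1 Y1 != 0 ->
    pi X1 * heat_bath e R v X1 Y1 = pi Y1 * heat_bath e R v Y1 X1.
  case: (eqVneq (pi X * heat_bath e R v X Y) 0) => [E|/H//].
  by case: (eqVneq (pi Y * heat_bath e R v Y X) 0) => [->//|/H <-].
rewrite mulf_eq0 negb_or /uniform_proper /heat_bath.
case: ifP; rewrite ?eqxx // => pX /andP[_].
case: ifP; rewrite ?eqxx // => /andP[ag m] _.
have E : Y1 = recolor X1 v (Y1 v) by apply/eqP; rewrite eq_recolor ag eqxx.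
have pY : Defs.proper e Y1 by rewrite E; apply: proper_recolor.
have AE : available e Y1 v = available e X1 v.
  by rewrite E available_recolor //; case: hsimple => _ ->.
have ag' : agree_off v Y1 X1.
  apply/forallP => w; apply/implyP => wv.
  by have /forallP/(_ w)/implyP/(_ wv) := ag; rewrite eq_sym.
by rewrite pY AE ag' proper_available.
Qed.

Lemma heat_bath_invariant v Y : \sum_X pi X * heat_bath e R v X Y = pi Y.
Proof.
under eq_bigr => X _ do rewrite heat_bath_reversible.
by rewrite -mulr_sumr heat_bath_sum1 mulr1.
Qed.

(** Invariance stated for test functions: recoloring [v] in a stationary coloring changes no
    expectation. The concentration argument rests on this. *)
Lemma heat_bath_expectation v (f : coloring V k -> R) :
  \sum_X pi X * (#|available e X v|%:R^-1 *
     \sum_(c in available e X v) f (recolor X v c)) = \sum_X pi X * f X.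
Proof.
under eq_bigr => X _ do rewrite -sum_heat_bath mulr_sumr.
rewrite exchange_big /=; apply: eq_bigr => Y _.
under eq_bigr => X _ do rewrite mulrA.
by rewrite -mulr_suml heat_bath_invariant.
Qed.

Hypothesis hV : (0 < #|V|)%N.

Lemma glauber_ge0 X Y : 0 <= glauber e R X Y.
Proof.
apply: mulr_ge0; first by rewrite invr_ge0 ler0n.
by apply: sumr_ge0 => v _; apply: heat_bath_ge0.
Qed.

Lemma average_const (x : R) : #|V|%:R^-1 * (\sum_(v : V) x) = x.
Proof.
by rewrite sumr_const -[x *+ _]mulr_natl mulrA mulVf ?mul1r // pnatr_eq0 -lt0n.
Qed.

Lemma glauber_sum1 X : \sum_Y glauber e R X Y = 1.
Proof.
rewrite -mulr_sumr exchange_big /=.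
under eq_bigr => v _ do rewrite heat_bath_sum1.
exact: average_const.
Qed.

Lemma glauber_invariant Y : \sum_X pi X * glauber e R X Y = pi Y.
Proof.
under eq_bigr => X _ do rewrite mulrCA mulr_sumr.
rewrite -mulr_sumr exchange_big /=.
under eq_bigr => v _ do rewrite heat_bath_invariant.
exact: average_const.
Qed.

Lemma glauber_law_ge0 X t Y : 0 <= glauber_law e R X t Y.
Proof.
elim: t Y => [|t IH] Y /=; first exact: ler0n.
by apply: sumr_ge0 => Z _; rewrite mulr_ge0 ?glauber_ge0.
Qed.

Lemma glauber_law_sum1 X t : \sum_Y glauber_law e R X t Y = 1.
Proof.
elim: t => [|t IH] /=.
  by under eq_bigr => Y _ do rewrite -[(_ == _)%:R]mul1r; rewrite sum_mul_eq.
rewrite exchange_big /=.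
by under eq_bigr => Y _ do rewrite -mulr_sumr glauber_sum1 mulr1.
Qed.

Lemma glauber_lawD X s t Y :
  glauber_law e R X (s + t) Y =
  \sum_Z glauber_law e R X s Z * glauber_law e R Z t Y.
Proof.
elim: t Y => [|t IH] Y.
  by rewrite addn0 /=; under eq_bigr => Z _ do rewrite eq_sym; rewrite sum_mul_eq.
rewrite addnS /=; under [LHS]eq_bigr => Z _ do rewrite IH mulr_suml.
rewrite exchange_big /=; apply: eq_bigr => Z _.
by rewrite mulr_sumr; apply: eq_bigr => W _; rewrite mulrA.
Qed.

Lemma glauber_law_invariant t Y : \sum_X pi X * glauber_law e R X t Y = pi Y.
Proof.
elim: t Y => [|t IH] Y /=.
  by under eq_bigr => Z _ do rewrite eq_sym; rewrite sum_mul_eq.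
under eq_bigr => X _ do rewrite mulr_sumr.
rewrite exchange_big /=.
under eq_bigr => Z _ do under eq_bigr => X _ do rewrite mulrA.
under eq_bigr => Z _ do rewrite -mulr_suml IH.
exact: glauber_invariant.
Qed.

Lemma tv_dist_ge0 (mu nu : coloring V k -> R) : 0 <= tv_dist mu nu.
Proof. by rewrite mulr_ge0 ?invr_ge0 ?ler0n // sumr_ge0. Qed.

Lemma tv_dist_le1 X t : tv_dist (glauber_law e R X t) pi <= 1.
Proof.
rewrite /tv_dist ler_pdivrMl ?ltr0n // mulr1.
apply: (@le_trans _ _ (\sum_Y (glauber_law e R X t Y + pi Y))).
  apply: ler_sum => Y _; apply: le_trans (ler_normB _ _) _.
  by rewrite !ger0_norm ?glauber_law_ge0 ?uniform_proper_ge0.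
by rewrite big_split /= glauber_law_sum1 (sum_uniform_proper X).
Qed.

(** The signed measure [mu] has total mass zero, so [pi Y] may be subtracted from every
    [glauber_law e R Z t Y] before taking absolute values. The factor 2 undoes the normalization of
    [tv_dist]. *)
Lemma tv_dist_contract (eps : R) t X s :
  (forall Z, tv_dist (glauber_law e R Z t) pi <= eps) ->
  tv_dist (glauber_law e R X (s + t)) pi <=
  2 * eps * tv_dist (glauber_law e R X s) pi.
Proof.
move=> H; set mu := fun Z => glauber_law e R X s Z - pi Z.
have mu0 : \sum_Z mu Z = 0.
  by rewrite sumrB glauber_law_sum1 (sum_uniform_proper X) subrr.
have E Y : glauber_law e R X (s + t) Y - pi Y =
    \sum_Z mu Z * (glauber_law e R Z t Y - pi Y).
  under [RHS]eq_bigr => Z _ do rewrite mulrBr.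
  rewrite sumrB -mulr_suml mu0 mul0r subr0 glauber_lawD.
  rewrite -{1}(glauber_law_invariant t Y) -sumrB.
  by apply: eq_bigr => Z _; rewrite mulrBl.
rewrite /tv_dist mulrCA ler_pM2l ?invr_gt0 ?ltr0n //.
apply: (@le_trans _ _
  (\sum_Y \sum_Z `|mu Z| * `|glauber_law e R Z t Y - pi Y|)).
  apply: ler_sum => Y _; rewrite E; apply: le_trans (ler_norm_sum _ _ _) _.
  by apply: ler_sum => Z _; rewrite normrM.
rewrite exchange_big mulr_sumr /=; apply: ler_sum => Z _.
rewrite -mulr_sumr mulrC; apply: ler_wpM2r => //.
by rewrite -ler_pdivrMl ?ltr0n //; apply: H.
Qed.

(** The [r] leftover steps run first, where the trivial bound 1 suffices; each later block of [t]
    steps contributes one factor. *)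
Lemma tv_dist_iter (eps : R) t X r j :
  (forall Z, tv_dist (glauber_law e R Z t) pi <= eps) ->
  tv_dist (glauber_law e R X (r + j * t)) pi <= (2 * eps) ^+ j.
Proof.
move=> H; have eps0 : 0 <= eps := le_trans (tv_dist_ge0 _ _) (H X).
elim: j => [|j IH]; first by rewrite expr0; apply: tv_dist_le1.
rewrite mulSnr addnA; apply: le_trans (tv_dist_contract _ _ H) _.
by rewrite exprS ler_wpM2l // mulr_ge0.
Qed.
End Dynamics.

(** * Concentration of the number of available colors *)

Section RealInequalities.
Variable R : realType.
Implicit Types (x y a : R).

(** Squaring and inverting 1 - x/2 <= exp(-x/2) bounds exp(x) by (1 - x/2)^(-2). Multiplying out,
    the claim reduces to 1 - 3x + x^2 >= 0, which holds up to 1/3. *)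
Lemma expR_le_quadratic x : 0 <= x <= 3^-1 -> expR x <= 1 + x + x ^+ 2.
Proof.
move=> /andP[x0 x1].
have h : 1 - x / 2 <= expR (- (x / 2)) := expR_ge1Dx _.
have E : expR x = (expR (- (x / 2)) ^+ 2)^-1.
  by rewrite -expRM_natl -expRN; congr expR; field.
have p : 0 < 1 - x / 2 by lra.
have hh : (1 - x / 2) ^+ 2 <= expR (- (x / 2)) ^+ 2.
  by rewrite ler_pXn2r // nnegrE ltW // expR_gt0.
have pp : 0 < (1 - x / 2) ^+ 2 by rewrite exprn_gt0.
rewrite E; apply: (@le_trans _ _ ((1 - x / 2) ^+ 2)^-1).
  by rewrite lef_pV2 // posrE // exprn_gt0 // expR_gt0.
rewrite invf_ple ?posrE //; last by nra.
rewrite -[_^-1]mul1r ler_pdivrMr; last by nra.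
by nra.
Qed.

(** The inverse of 1 - 1/a is 1 + 1/(a - 1), which is at most exp(1/(a - 1)). *)
Lemma expRN_le_1Binv a : 1 < a -> expR (- (a - 1)^-1) <= 1 - a^-1.
Proof.
move=> a1; have a0 : 0 < a by lra.
have b0 : 0 < a - 1 by lra.
rewrite expRN invf_ple ?posrE ?expR_gt0 //; last first.
  by rewrite subr_gt0 invf_lt1.
apply: le_trans (expR_ge1Dx _).
rewrite le_eqVlt; apply/orP; left; apply/eqP; field.
by rewrite !gt_eqF.
Qed.

(** Jensen's inequality, obtained by summing the tangent line of exp(-s) at [m]. *)
Lemma jensen_expRN (I : finType) (S : I -> R) (m : R) :
  \sum_i S i <= #|I|%:R * m -> #|I|%:R * expR (- m) <= \sum_i expR (- S i).
Proof.
move=> H; apply: (@le_trans _ _ (\sum_i expR (- m) * (1 + (m - S i)))).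
  rewrite -mulr_sumr big_split sumrB /= !sumr_const mulrC.
  rewrite -[m *+ _]mulr_natl ler_wpM2l ?expR_ge0 //; lra.
apply: ler_sum => i _.
rewrite [leRHS](_ : _ = expR (- m) * expR (m - S i)); last first.
  by rewrite -expRD; congr expR; ring.
by rewrite ler_wpM2l ?expR_ge0 // expR_ge1Dx.
Qed.

Lemma expR1_le4 : expR 1 <= 4 :> R.
Proof.
have h : 1 - 2^-1 <= expR (- 2^-1) :> R := expR_ge1Dx _.
have -> : expR 1 = (expR (- 2^-1) ^+ 2)^-1 :> R.
  by rewrite -expRM_natl -expRN; congr expR; field.
rewrite invf_ple ?posrE ?exprn_gt0 ?expR_gt0 //.
have -> : 4^-1 = (1 - 2^-1) ^+ 2 :> R by field.
by rewrite ler_pXn2r // nnegrE ?expR_ge0 //; lra.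
Qed.

End RealInequalities.

(** * Exponential moments under successive resampling of a neighborhood *)

Section Concentration.
Variables (V : finType) (e : rel V) (k : nat) (R : realType).
Hypothesis hdeg : (max_degree e < k)%N.
Hypothesis hsimple : simple_graph e.
Hypothesis htri : triangle_free e.
Implicit Types (X Y Z : coloring V k) (v w : V) (c : 'I_k) (l : seq V).
Implicit Types (f : coloring V k -> R).

Notation pi := (@uniform_proper V e k R).

(** The heat-bath kernel at [w] acting on observables. In [foldr resample f l] the head of [l] is
    the vertex resampled first. *)
Definition resample w f X : R :=
  #|available e X w|%:R^-1 * \sum_(c in available e X w) f (recolor X w c).

Lemma resample_seq_expectation l f :
  \sum_X pi X * foldr resample f l X = \sum_X pi X * f X.
Proof.
by elim: l => //= w l <-; rewrite (heat_bath_expectation hdeg hsimple).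
Qed.

Definition unhit v l X : {set 'I_k} :=
  ~: [set X w | w in [pred w | e v w && (w \notin l)]].

(** The probability that no vertex of [l] picks [c] when the vertices of [l] are resampled; the
    product form is correct when [l] is an independent set. *)
Definition survival l X c : R :=
  \prod_(w <- l) (1 - (c \in available e X w)%:R / #|available e X w|%:R).

(* For l contained in N(v), the mean number of colors available at v once the
   vertices of l have been resampled. *)
Definition expected_unhit v l X : R :=
  \sum_(c in unhit v l X) survival l X c.

Lemma hit_prob_itv X w c :
  0 <= (c \in available e X w)%:R / #|available e X w|%:R :> R /\
  (c \in available e X w)%:R / #|available e X w|%:R <= 1 :> R.
Proof.
have a0 : 0 < #|available e X w|%:R :> R by rewrite ltr0n available_gt0.
split; rewrite ?divr_ge0 ?ler0n // ler_pdivrMr // mul1r ler_nat.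
by apply: leq_trans (leq_b1 _) _; apply: available_gt0.
Qed.

Lemma survival_itv l X c : 0 <= survival l X c <= 1.
Proof.
rewrite /survival; elim: l => [|w l IH]; first by rewrite big_nil ler01 lexx.
rewrite big_cons; have := hit_prob_itv X w c; move: IH.
by move=> /andP[? ?] [? ?]; apply/andP; split; nra.
Qed.

Lemma survival_recolor l X w c d : (forall u, u \in l -> ~~ e u w) ->
  survival l (recolor X w c) d = survival l X d.
Proof.
move=> H; rewrite /survival; apply: eq_big_seq => u ul.
by rewrite available_recolor // H.
Qed.

Lemma unhit_recolor v l X w c : e v w -> w \notin l ->
  unhit v l (recolor X w c) = unhit v (w :: l) X :\ c.
Proof.
move=> evw wl; apply/setP => d; rewrite !inE.
rewrite -negb_or; congr (~~ _); apply/imsetP/orP.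
  move=> [u]; rewrite !inE recolorE => /andP[vu ul].
  case: eqP => [_ ->|/eqP uw E]; first by left.
  by right; apply/imsetP; exists u => //; rewrite !inE vu negb_or uw.
case=> [/eqP ->|/imsetP[u]].
  by exists w; rewrite ?inE ?evw // recolorE eqxx.
rewrite !inE negb_or => /andP[vu /andP[/negPf uw ul]] E.
by exists u; rewrite ?inE ?vu // recolorE uw.
Qed.

Lemma unhit0 v X : unhit v [::] X = available e X v.
Proof.
congr (~: _); apply/setP => c.
by apply/imsetP/imsetP => -[w]; rewrite !inE ?andbT => vw ->;
  exists w; rewrite ?inE ?vw.
Qed.

(** Revealing the color [c] of [w] removes exactly the term of [c]. Compared with
    [expected_unhit_cons], where the average of this term is removed, it gives the martingale
    increment. *)
Lemma expected_unhit_recolor v l X w c : e v w -> w \notin l ->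
  (forall u, u \in l -> ~~ e u w) ->
  expected_unhit v l (recolor X w c) =
  \sum_(d in unhit v (w :: l) X) survival l X d -
  (c \in unhit v (w :: l) X)%:R * survival l X c.
Proof.
move=> evw wl H; rewrite /expected_unhit unhit_recolor //.
under eq_bigr => d _ do rewrite survival_recolor //.
case: (boolP (c \in _)) => cU.
  by rewrite [in RHS](big_setD1 c) //= mul1r addrC addrK.
rewrite mul0r subr0; apply: eq_bigl => d; rewrite !inE.
by case: eqP cU => // ->; rewrite inE => /negPf ->.
Qed.

Lemma expected_unhit_cons v l X w :
  expected_unhit v (w :: l) X =
  \sum_(d in unhit v (w :: l) X) survival l X d -
  #|available e X w|%:R^-1 * \sum_(c in available e X w)
     (c \in unhit v (w :: l) X)%:R * survival l X c.
Proof.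
rewrite /expected_unhit /survival.
under eq_bigr => c _ do rewrite big_cons mulrBl mul1r.
rewrite sumrB; congr (_ - _); rewrite mulr_sumr big_mkcond [RHS]big_mkcond /=.
apply: eq_bigr => c _.
by case: (c \in unhit _ _ _); case: (c \in available _ _ _);
  rewrite ?(mul0r, mul1r, mulr0).
Qed.

(* Revealing the colors of [l] one at a time, each conditional mean of the number
   of unhit colors moves by at most one, as in the proof of Azuma's inequality. *)
Lemma resample_seq_mgf v l (lam : R) X : 0 <= lam <= 3^-1 -> uniq l ->
  (forall w, w \in l -> e v w) ->
  foldr resample (fun Y => expR (- lam * #|available e Y v|%:R)) l X <=
  expR (- lam * expected_unhit v l X + lam ^+ 2 * (size l)%:R).
Proof.
move=> lamP; elim: l X => [|w l IH] X.
  move=> _ _; rewrite /= mulr0 addr0 /expected_unhit unhit0 ler_expR.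
  rewrite (eq_bigr (fun=> 1)) ?sumr_const // => c _.
  by rewrite /survival big_nil.
move=> /=/andP[wl ul] Hl.
have evw : e v w by apply: Hl; rewrite mem_head.
have Hl' u : u \in l -> e v u by move=> h; apply: Hl; rewrite inE h orbT.
(* Triangle-freeness enters here: two neighbors of [v] are not adjacent, so recoloring [w] leaves
   the available sets of the vertices of [l] intact. *)
have ind u : u \in l -> ~~ e u w.
  move=> /Hl' evu; apply/negP => euw.
  have := htri v u w; rewrite evu euw /=.
  by case: hsimple => -> _; rewrite evw.
set a : R := #|available e X w|%:R.
have a0 : 0 < a by rewrite ltr0n available_gt0.
set F := \sum_(d in unhit v (w :: l) X) survival l X d.
pose z c := (c \in unhit v (w :: l) X)%:R * survival l X c.
have zP c : 0 <= z c <= 1.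
  rewrite /z; case: (_ \in _); rewrite ?mul0r ?mul1r ?survival_itv //.
  by rewrite lexx ler01.
pose m : R := (size l)%:R.
set zbar := a^-1 * \sum_(c in available e X w) z c.
rewrite expected_unhit_cons -/F -/a -/zbar.
rewrite {1}/resample -/a.
(* Since [z c] lies in [0, 1], exp(lam z) <= 1 + lam z + lam^2. This bound is affine in z, so
   averaging over [c] replaces [z c] by [zbar], and 1 + x <= exp(x) then restores an exponential. *)
apply: (@le_trans _ _ (a^-1 * \sum_(c in available e X w)
   (expR (- lam * F + lam ^+ 2 * m) * (1 + lam ^+ 2 + lam * z c)))).
  rewrite ler_wpM2l ?invr_ge0 ?(ltW a0) //; apply: ler_sum => c _.
  apply: le_trans (IH _ ul Hl') _.
  rewrite expected_unhit_recolor // -/F -/(z c) -/m.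
  have -> : - lam * (F - z c) + lam ^+ 2 * m =
    - lam * F + lam ^+ 2 * m + lam * z c by ring.
  rewrite expRD ler_wpM2l ?expR_ge0 //.
  move: (zP c) lamP => /andP[z0 z1] /andP[l0 l1].
  apply: le_trans (expR_le_quadratic _) _; first by apply/andP; split; nra.
  suff : (lam * z c) ^+ 2 <= lam ^+ 2 by lra.
  by rewrite exprMn ler_piMr ?exprn_ge0 ?exprn_ile1.
rewrite -mulr_sumr mulrCA big_split /= sumr_const -mulr_sumr.
rewrite mulrDr [a^-1 * (lam * _)]mulrCA -/zbar.
rewrite -[_ *+ _]mulr_natl -/a mulrA mulVf ?gt_eqF // mul1r.
have -> : - lam * (F - zbar) + lam ^+ 2 * (size l).+1%:R =
  (- lam * F + lam ^+ 2 * m) + (lam ^+ 2 + lam * zbar).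
  by rewrite -natr1 -/m; ring.
by rewrite [leRHS]expRD ler_wpM2l ?expR_ge0 // -addrA expR_ge1Dx.
Qed.

End Concentration.

(** * Lower tail of the number of available colors under the stationary law *)

Section AvailableColors.
Variables (V : finType) (e : rel V) (k : nat) (R : realType).
Hypothesis hdeg : ((max_degree e).+1 < k)%N.
Hypothesis hsimple : simple_graph e.
Hypothesis htri : triangle_free e.
Implicit Types (X Y Z : coloring V k) (v w : V) (c : 'I_k) (l : seq V).

Notation pi := (@uniform_proper V e k R).
Notation D := (max_degree e).

(** Uniform upper bound for 1/(a - 1) over the sizes a of available sets, all of which are at least
    [k - D]. *)
Let eta : R := (k%:R - D%:R - 1)^-1.

Let hdegW : (D < k)%N. Proof. exact: ltnW. Qed.

Lemma available_gt1 X v : 1 < #|available e X v|%:R :> R.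
Proof.
have := leq_trans hdeg (card_available e X v).
by rewrite -[D.+1]add1n ltn_add2r ltr1n.
Qed.

Lemma survival_ge l X c :
  expR (- \sum_(w <- l) (c \in available e X w)%:R * (#|available e X w|%:R - 1)^-1)
  <= survival e R l X c.
Proof.
rewrite -sumrN expR_sum /survival.
apply: ler_prod => w _; rewrite expR_ge0 /=.
case: (_ \in _); last by rewrite /= mulr0n !mul0r oppr0 expR0 addr0.
by rewrite !mul1r; apply: expRN_le_1Binv; apply: available_gt1.
Qed.

Lemma expected_unhit_ge v X :
  k%:R * expR (- (D%:R / k%:R * (1 + eta))) <=
  expected_unhit e R v (enum (neighbors e v)) X.
Proof.
have k0 : 0 < k%:R :> R by rewrite ltr0n (leq_ltn_trans _ hdeg).
have gap : 0 < k%:R - D%:R - 1 :> R.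
  by rewrite -addrA -opprD natr1 subr_gt0 ltr_nat.
(* With all of N(v) still to be resampled, no color has been hit yet. *)
rewrite /expected_unhit (_ : unhit _ _ _ _ = setT); last first.
  apply/setP => c; rewrite !inE; apply/imsetP => -[w].
  by rewrite !inE mem_enum inE => /andP[->].
rewrite (eq_bigl xpredT) => [|c]; last by rewrite inE.
apply: le_trans (ler_sum _ (fun c _ => survival_ge _ X c)).
(* It remains to bound the exponents summed over all colors: a neighbor with a available colors
   contributes a/(a - 1) = 1 + 1/(a - 1) <= 1 + [eta], and there are at most [D] neighbors. *)
rewrite -{1}(card_ord k); apply: jensen_expRN.
rewrite card_ord exchange_big /=.
rewrite [leRHS](_ : _ = D%:R * (1 + eta)); last first.
  by rewrite mulrA mulrCA mulfV ?mulr1 ?gt_eqF.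
apply: (@le_trans _ _ (\sum_(w <- enum (neighbors e v)) (1 + eta))).
  apply: ler_sum => w _; rewrite -mulr_suml.
  rewrite (_ : \sum_i _ = #|available e X w|%:R); last first.
    rewrite -sum1_card natr_sum [RHS]big_mkcond /=.
    by apply: eq_bigr => c _; case: (_ \in _).
  have a1 := available_gt1 X w; set a := #|_|%:R in a1 *.
  have a1' : 0 < a - 1 by rewrite subr_gt0.
  have -> : a * (a - 1)^-1 = 1 + (a - 1)^-1 by field; rewrite gt_eqF.
  rewrite lerD2l lef_pV2 ?posrE // lerD2r lerBlDr /a -natrD ler_nat.
  exact: card_available.
rewrite big_const_seq count_predT iter_addr_0 -[leLHS]mulr_natl -cardE.
apply: ler_wpM2r; first by rewrite addr_ge0 // invr_ge0 ltW.
by rewrite ler_nat /max_degree; apply: (leq_bigmax v).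
Qed.

(** A Chernoff bound. By stationarity the exponential moment is unchanged when all of N(v) is
    resampled first, and the resampled moment is bounded pointwise in the coloring. *)
Lemma few_available_prob v (lam tau : R) (X0 : coloring V k) : 0 <= lam <= 3^-1 ->
  \sum_Y pi Y * (#|available e Y v|%:R < tau :> R)%:R <=
  expR (lam * tau - lam * (k%:R * expR (- (D%:R / k%:R * (1 + eta)))) +
        lam ^+ 2 * D%:R).
Proof.
move=> lamP; have /andP[lam0 _] := lamP.
set f := fun Y : coloring V k => expR (- lam * #|available e Y v|%:R).
set M := _ * expR _.
have pi0 := @uniform_proper_ge0 V e k R.
apply: (@le_trans _ _ (\sum_Y pi Y * (expR (lam * tau) * f Y))).
  apply: ler_sum => Y _; apply: ler_wpM2l => //.
  rewrite -expRD; case: ltP => h; last exact: expR_ge0.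
  by apply: le_trans (expR_ge1Dx _); rewrite lerDl; nra.
under eq_bigr => Y _ do rewrite mulrCA.
rewrite -mulr_sumr -(resample_seq_expectation hdegW hsimple (enum (neighbors e v)) f).
rewrite -addrA expRD ler_wpM2l ?expR_ge0 //.
apply: (@le_trans _ _ (\sum_Y pi Y * expR (- (lam * M) + lam ^+ 2 * D%:R))); last first.
  by rewrite -mulr_suml (sum_uniform_proper _ hdegW hsimple X0) mul1r.
apply: ler_sum => Y _; apply: ler_wpM2l => //.
apply: le_trans (resample_seq_mgf hdegW hsimple htri Y lamP (enum_uniq _) _) _.
  by move=> w; rewrite mem_enum inE.
rewrite ler_expR mulNr; apply: lerD.
  by rewrite lerN2; apply: ler_wpM2l => //; apply: expected_unhit_ge.
rewrite ler_wpM2l ?exprn_ge0 // ler_nat -cardE.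
by rewrite /max_degree; apply: (leq_bigmax v).
Qed.

End AvailableColors.

(** * Numerical estimates for [alpha] and for the Chernoff exponent *)

Lemma alpha_itv (R : realType) (alpha : R) :
  alpha = expR (1 / alpha) -> 8 / 5 <= alpha <= 2.
Proof.
move=> h; have a0 : 0 < alpha by rewrite h expR_gt0.
have i0 : 0 < 1 / alpha by rewrite divr_gt0.
have E : alpha * (1 / alpha) = 1 by field; rewrite gt_eqF.
have lo : 1 + 1 / alpha <= alpha by rewrite [leRHS]h; apply: expR_ge1Dx.
have hi : 1 - 1 / alpha <= 1 / alpha.
  rewrite [leRHS](_ : _ = expR (- (1 / alpha))); first exact: expR_ge1Dx.
  by rewrite expRN -h mul1r.
move: (1 / alpha) i0 E lo hi => i i0 E lo hi.
(* This puts [alpha] above the golden ratio, hence above 8/5. *)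
have sq : alpha + 1 <= alpha * alpha.
  by rewrite -[X in _ + X]E -[X in X + _]mulr1 -mulrDr ler_pM2l.
have le2 : alpha <= alpha * (2 * i) by rewrite ler_peMr ?(ltW a0) //; lra.
by apply/andP; split; nra.
Qed.

(** The Chernoff exponent at [lam] = z/6 and [tau] = (1 + z/5) D. The mean exceeds [tau] by at least
    zK/5 - 3, which outweighs the quadratic term because D <= 5K/8. *)
Lemma large_deviation_exponent (R : realType) (alpha z D K L : R) :
  alpha = expR (1 / alpha) -> 0 < z < 1 -> 0 <= D ->
  (1 + z) * alpha * D <= K -> 288 * L <= z ^+ 2 * K -> 1 <= L ->
  z / 6 * ((1 + z / 5) * D) -
  z / 6 * (K * expR (- (D / K * (1 + (K - D - 1)^-1)))) + (z / 6) ^+ 2 * D <= - L.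
Proof.
move=> halpha /andP[z0 z1] D0 hK hL L1.
have /andP[alo ahi] := alpha_itv halpha.
have zzK : 288 <= z ^+ 2 * K by lra.
have K0 : 0 < K by rewrite -(pmulr_rgt0 _ (exprn_gt0 2 z0)); lra.
have zK : 288 <= z * K.
  by apply: le_trans zzK _; rewrite ler_pM2r // expr2 ler_piMr // ltW.
have K288 : 288 <= K by apply: le_trans zK _; rewrite ler_piMl // ltW.
have hD : 8 * D <= 5 * K.
  have h : 8 / 5 <= (1 + z) * alpha by nra.
  have := ler_wpM2r D0 h; lra.
set x := D / K; set eta := (K - D - 1)^-1.
have Dx : D = x * K by rewrite /x divfK // gt_eqF.
have x0 : 0 <= x by rewrite divr_ge0 // ltW.
have x1 : x <= 1 by rewrite ler_pdivrMr // mul1r; lra.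
have gap : K / 3 <= K - D - 1 by lra.
have eta0 : 0 <= eta by rewrite invr_ge0; lra.
have etaK : eta * K <= 3.
  by rewrite /eta mulrC ler_pdivrMr; lra.
set b := 1 / alpha in halpha.
have ab : alpha * b = 1 by rewrite /b mul1r mulfV // gt_eqF; lra.
have b2 : 1 / 2 <= b by nra.
have xb : (1 + z) * x <= b.
  have : (1 + z) * alpha * x <= 1.
    by rewrite /x mulrA ler_pdivrMr // mul1r.
  nra.
have Eb : expR (- b) = b by rewrite expRN -halpha /b mul1r.
have e1 : b <= expR (- x) by rewrite -[leLHS]Eb ler_expR lerN2; nra.
(* The correction [eta] costs at most [eta], as both x and exp(-x) are at most 1. *)
have e2 : expR (- x) - eta <= expR (- (x * (1 + eta))).
  have -> : - (x * (1 + eta)) = - x + - (x * eta) by ring.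
  rewrite expRD.
  have h1 : 1 - x * eta <= expR (- (x * eta)) := expR_ge1Dx _.
  have h2 : expR (- x) <= 1 by rewrite expR_le1 oppr_le0.
  have h3 := expR_ge0 (- x).
  apply: (@le_trans _ _ (expR (- x) * (1 - x * eta))); last exact: ler_wpM2l.
  have : expR (- x) * (x * eta) <= 1 * (1 * eta).
    by apply: ler_pM => //; [exact: mulr_ge0 | exact: ler_wpM2r].
  lra.
set E := expR (- (x * (1 + eta))) in e2 *.
(* From x <= b/(1 + z), the right side is at least (4z/5) b/(1 + z), and b >= 1/2, z < 1. *)
have e3 : z / 5 <= b - (1 + z / 5) * x by nra.
have e4 : z / 5 * K - 3 <= K * E - (1 + z / 5) * D.
  have : (z / 5 - eta) * K <= (E - (1 + z / 5) * x) * K by rewrite ler_pM2r //; lra.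
  rewrite Dx; lra.
have e5 : z / 6 * (z / 5 * K - 3) <= z / 6 * (K * E - (1 + z / 5) * D).
  by rewrite ler_pM2l //; lra.
have e6 : z ^+ 2 * (8 * D) <= z ^+ 2 * (5 * K) by rewrite ler_wpM2l // exprn_ge0 // ltW.
(* The gain z^2 K/30 - z/2 less the loss 5 z^2 K/288 is at least 23 z^2 K/1440 - 1/2 >= 4.6 L - 1/2
   >= L. *)
lra.
Qed.

(** * Coupling with the stationary chain *)

Section MaximalCoupling.
Variables (R : realType) (T : finType).
Implicit Types (p q : T -> R) (a b : T) (A B : {set T}).

Definition overlap p q : R := \sum_a Num.min (p a) (q a).

(** The common mass sits on the diagonal and the residual masses are coupled independently. If the
    overlap is 1, the division by zero returns 0, as it should, because the residuals vanish. *)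
Definition maximal_coupling p q a b : R :=
  (a == b)%:R * Num.min (p a) (q a) +
  (p a - Num.min (p a) (q a)) * (q b - Num.min (p b) (q b)) / (1 - overlap p q).

Lemma overlap_le1 p q : \sum_a p a = 1 -> overlap p q <= 1.
Proof. by move=> <-; apply: ler_sum => a _; rewrite ge_min lexx. Qed.

Lemma overlapC p q : overlap p q = overlap q p.
Proof. by apply: eq_bigr => a _; rewrite minC. Qed.

Lemma maximal_couplingC p q a b : maximal_coupling p q a b = maximal_coupling q p b a.
Proof.
rewrite /maximal_coupling overlapC (minC (q a)) (minC (q b)) eq_sym.
rewrite [X in _ + X / _]mulrC; congr (_ + _).
by case: eqP => [->|]; rewrite ?mul0r.
Qed.

Lemma maximal_coupling_ge0 p q a b : (forall c, 0 <= p c) -> (forall c, 0 <= q c) ->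
  \sum_a p a = 1 -> 0 <= maximal_coupling p q a b.
Proof.
move=> p0 q0 p1; apply: addr_ge0.
  by rewrite mulr_ge0 ?ler0n // le_min p0 q0.
rewrite divr_ge0 ?subr_ge0 ?overlap_le1 // mulr_ge0 // subr_ge0 ge_min lexx //.
exact: orbT.
Qed.

Lemma maximal_coupling_suml p q a : \sum_a p a = 1 -> \sum_a q a = 1 ->
  \sum_b maximal_coupling p q a b = p a.
Proof.
move=> p1 q1; rewrite big_split /=.
under eq_bigr => b _ do rewrite mulrC eq_sym.
rewrite (bigD1 a) //= eqxx mulr1 big1 => [|b /negPf ->]; last by rewrite mulr0.
rewrite addr0 -mulr_suml -mulr_sumr sumrB q1 -/(overlap p q).
have [E|/eqP ne] := 1 - overlap p q =P 0; last by rewrite mulfK // addrC subrK.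
suff : p a - Num.min (p a) (q a) = 0.
  by rewrite E => /eqP; rewrite subr_eq0 => /eqP <-; rewrite mulr0 mul0r addr0.
move: E; rewrite -p1 -sumrB => /eqP; rewrite psumr_eq0 => [/allP/(_ a)|c _].
  by rewrite mem_index_enum => /(_ isT)/eqP.
by rewrite subr_ge0 ge_min lexx.
Qed.

Lemma maximal_coupling_sumr p q b : \sum_a p a = 1 -> \sum_a q a = 1 ->
  \sum_a maximal_coupling p q a b = q b.
Proof.
move=> p1 q1; under eq_bigr => a _ do rewrite maximal_couplingC.
exact: maximal_coupling_suml.
Qed.

Lemma maximal_coupling_neq p q : (forall c, 0 <= p c) -> (forall c, 0 <= q c) ->
  \sum_a p a = 1 -> \sum_a q a = 1 ->
  \sum_a \sum_b maximal_coupling p q a b * (a != b)%:R <= 1 - overlap p q.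
Proof.
move=> p0 q0 p1 q1.
have tot : \sum_a \sum_b maximal_coupling p q a b = 1.
  by rewrite -p1; apply: eq_bigr => a _; rewrite maximal_coupling_suml.
rewrite lerBrDr -[leRHS]tot /overlap -big_split /=.
apply: ler_sum => a _.
rewrite [leRHS](bigD1 a) //= [X in X + _](bigD1 a) //= eqxx mulr0 add0r addrC.
apply: lerD.
  rewrite /maximal_coupling eqxx mul1r lerDl.
  by rewrite divr_ge0 ?subr_ge0 ?overlap_le1 // mulr_ge0 // subr_ge0 ge_min lexx ?orbT.
by apply: ler_sum => b ne; rewrite eq_sym ne mulr1.
Qed.

Definition uniform_on A c : R := #|A|%:R^-1 * (c \in A)%:R.

Lemma uniform_on_ge0 A c : 0 <= uniform_on A c.
Proof. by rewrite mulr_ge0 ?invr_ge0 ?ler0n. Qed.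

Lemma sum_uniform_on A : (0 < #|A|)%N -> \sum_c uniform_on A c = 1.
Proof.
move=> A0; rewrite -mulr_sumr -natr_sum -big_mkcond /= sum1_card mulVf //.
by rewrite pnatr_eq0 -lt0n.
Qed.

(** With M the larger cardinality, the overlap is at least |A & B|/M and M <= |A & B| + d. Weakening
    d/M to d/|B| makes the bound depend on one set only, later that of the stationary copy. *)
Lemma overlap_uniform A B d : (0 < #|A|)%N -> (0 < #|B|)%N ->
  (#|A :\: B| <= d)%N -> (#|B :\: A| <= d)%N ->
  1 - overlap (uniform_on A) (uniform_on B) <= d%:R / #|B|%:R.
Proof.
move=> A0 B0 dA dB.
pose M := maxn #|A| #|B|.
have M0 : 0 < M%:R :> R by rewrite ltr0n /M leq_max A0.
have AR : 0 < #|A|%:R :> R by rewrite ltr0n.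
have BR : 0 < #|B|%:R :> R by rewrite ltr0n.
have h : #|A :&: B|%:R / M%:R <= overlap (uniform_on A) (uniform_on B).
  rewrite -sum1_card natr_sum mulr_suml big_mkcond /=; apply: ler_sum => c _.
  rewrite !inE /uniform_on le_min; case: (c \in A); case: (c \in B);
    rewrite /= ?mulr1 ?mulr0 ?mul1r ?invr_ge0 ?ler0n ?lexx //.
  by rewrite !lef_pV2 ?posrE // !ler_nat leq_maxl leq_maxr.
have hM : (M <= #|A :&: B| + d)%N.
  rewrite geq_max -[X in (X <= _)%N && _](cardsID B A).
  by rewrite -[#|B|](cardsID A B) [B :&: A]setIC !leq_add2l dA dB.
have hB : d%:R / M%:R <= d%:R / #|B|%:R :> R.
  by rewrite ler_wpM2l ?ler0n // lef_pV2 ?posrE // ler_nat leq_maxr.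
have hMR : 1 <= #|A :&: B|%:R / M%:R + d%:R / M%:R :> R.
  by rewrite -mulrDl -natrD ler_pdivlMr // mul1r ler_nat.
lra.
Qed.

End MaximalCoupling.

(** * The coupled chain and its expected Hamming distance *)

Section CoupledDynamics.
Variables (V : finType) (e : rel V) (k : nat) (R : realType).
Hypothesis hdeg : (max_degree e < k)%N.
Hypothesis hsimple : simple_graph e.
Hypothesis hV : (0 < #|V|)%N.
Implicit Types (X Y Z : coloring V k) (v w : V) (a b c : 'I_k).

Notation pi := (@uniform_proper V e k R).
Notation D := (max_degree e).
Notation n := #|V|.

Definition color_coupling X Y v : 'I_k -> 'I_k -> R :=
  maximal_coupling (uniform_on R (available e X v)) (uniform_on R (available e Y v)).

Definition coupled_glauber X Y X' Y' : R :=
  n%:R^-1 * \sum_v \sum_a \sum_b color_coupling X Y v a b *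
    ((X' == recolor X v a)%:R * (Y' == recolor Y v b)%:R).

Definition hamming X Y : R := \sum_w (X w != Y w)%:R.

Lemma color_coupling_ge0 X Y v a b : 0 <= color_coupling X Y v a b.
Proof.
apply: maximal_coupling_ge0 => [c|c|]; try exact: uniform_on_ge0.
by rewrite sum_uniform_on // available_gt0.
Qed.

Lemma color_coupling_suml X Y v a :
  \sum_b color_coupling X Y v a b = uniform_on R (available e X v) a.
Proof.
by rewrite maximal_coupling_suml // sum_uniform_on // available_gt0.
Qed.

Lemma color_coupling_sumr X Y v b :
  \sum_a color_coupling X Y v a b = uniform_on R (available e Y v) b.
Proof.
by rewrite maximal_coupling_sumr // sum_uniform_on // available_gt0.
Qed.

Lemma glauberE X X' : glauber e R X X' =
  n%:R^-1 * \sum_v \sum_a uniform_on R (available e X v) a * (X' == recolor X v a)%:R.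
Proof.
congr (_ * _); apply: eq_bigr => v _; rewrite heat_bathE mulr_sumr big_mkcond /=.
apply: eq_bigr => a _; rewrite /uniform_on.
by case: (a \in _); rewrite ?mulr1 ?mulr0 ?mul0r.
Qed.

Lemma coupled_glauber_ge0 X Y X' Y' : 0 <= coupled_glauber X Y X' Y'.
Proof.
rewrite mulr_ge0 ?invr_ge0 ?ler0n //.
do 3 (apply: sumr_ge0 => ? _).
by rewrite mulr_ge0 ?mulr_ge0 ?ler0n // color_coupling_ge0.
Qed.

Lemma sum_eq1 (T : finType) (x : T) : \sum_y (y == x)%:R = 1 :> R.
Proof.
by under eq_bigr => y _ do rewrite -[(_ == _)%:R]mul1r; rewrite sum_mul_eq.
Qed.

Lemma coupled_glauber_suml X Y X' : \sum_Y' coupled_glauber X Y X' Y' = glauber e R X X'.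
Proof.
rewrite glauberE -mulr_sumr exchange_big /=; congr (_ * _); apply: eq_bigr => v _.
rewrite exchange_big /=; apply: eq_bigr => a _.
rewrite exchange_big /= -(color_coupling_suml X Y) mulr_suml.
by apply: eq_bigr => b _; rewrite -!mulr_sumr sum_eq1 mulr1.
Qed.

Lemma coupled_glauber_sumr X Y Y' : \sum_X' coupled_glauber X Y X' Y' = glauber e R Y Y'.
Proof.
rewrite glauberE -mulr_sumr exchange_big /=; congr (_ * _); apply: eq_bigr => v _.
rewrite exchange_big /=; under eq_bigr => a _ do rewrite exchange_big /=.
rewrite exchange_big /=; apply: eq_bigr => b _.
rewrite -(color_coupling_sumr X Y) mulr_suml.
by apply: eq_bigr => a _; rewrite -mulr_sumr -mulr_suml sum_eq1 mul1r.
Qed.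

Lemma coupled_glauber_expectation X Y (f : coloring V k -> coloring V k -> R) :
  \sum_X' \sum_Y' coupled_glauber X Y X' Y' * f X' Y' =
  n%:R^-1 * \sum_v \sum_a \sum_b
     color_coupling X Y v a b * f (recolor X v a) (recolor Y v b).
Proof.
transitivity (n%:R^-1 * \sum_X' \sum_Y' \sum_v \sum_a \sum_b color_coupling X Y v a b *
    ((X' == recolor X v a)%:R * (Y' == recolor Y v b)%:R) * f X' Y').
  rewrite mulr_sumr; apply: eq_bigr => X' _.
  rewrite mulr_sumr; apply: eq_bigr => Y' _.
  rewrite /coupled_glauber -mulrA mulr_suml; congr (_ * _).
  apply: eq_bigr => v _; rewrite mulr_suml; apply: eq_bigr => a _.
  by rewrite mulr_suml.
congr (_ * _).
under eq_bigr => X' _ do rewrite exchange_big /=.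
rewrite exchange_big /=; apply: eq_bigr => v _.
under eq_bigr => X' _ do rewrite exchange_big /=.
rewrite exchange_big /=; apply: eq_bigr => a _.
under eq_bigr => X' _ do rewrite exchange_big /=.
rewrite exchange_big /=; apply: eq_bigr => b _.
rewrite -(sum_mul_eq (fun X' => color_coupling X Y v a b * f X' (recolor Y v b))).
apply: eq_bigr => X' _.
rewrite -(sum_mul_eq (fun Y' => color_coupling X Y v a b * f X' Y')) mulr_suml.
by apply: eq_bigr => Y' _; ring.
Qed.

Lemma hamming_recolor X Y v a b :
  hamming (recolor X v a) (recolor Y v b) =
  hamming X Y - (X v != Y v)%:R + (a != b)%:R.
Proof.
rewrite /hamming (bigD1 v) //= [in RHS](bigD1 v) //= !recolorE eqxx.
rewrite (eq_bigr (fun w => (X w != Y w)%:R)) => [|w /negPf wv]; first by ring.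
by rewrite !recolorE wv.
Qed.

Definition color_mismatch X Y v : R :=
  \sum_a \sum_b color_coupling X Y v a b * (a != b)%:R.

(** A disagreement at [v] is erased when [v] is selected, with probability 1/n, and replaced by a
    possible mismatch of the two new colors. *)
Lemma coupled_glauber_hamming X Y :
  \sum_X' \sum_Y' coupled_glauber X Y X' Y' * hamming X' Y' =
  hamming X Y - n%:R^-1 * hamming X Y + n%:R^-1 * \sum_v color_mismatch X Y v.
Proof.
rewrite coupled_glauber_expectation.
have E v : \sum_a \sum_b color_coupling X Y v a b *
    hamming (recolor X v a) (recolor Y v b) =
    hamming X Y - (X v != Y v)%:R + color_mismatch X Y v.
  transitivity (\sum_a \sum_b
     (color_coupling X Y v a b * (hamming X Y - (X v != Y v)%:R) +
      color_coupling X Y v a b * (a != b)%:R)).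
    by do 2 (apply: eq_bigr => ? _); rewrite hamming_recolor mulrDr.
  under eq_bigr => a _ do rewrite big_split /= -mulr_suml color_coupling_suml.
  by rewrite big_split /= -mulr_suml sum_uniform_on ?available_gt0 // mul1r.
under eq_bigr => v _ do rewrite E.
by rewrite big_split sumrB !mulrDr /= average_const // mulrN.
Qed.

(** A color available in [X] but blocked in [Y] is the [Y]-color of a neighbor at which the two
    colorings disagree. *)
Lemma card_available_diff X Y v :
  (#|available e X v :\: available e Y v| <=
    #|[set w in neighbors e v | X w != Y w]|)%N.
Proof.
apply: leq_trans (subset_leq_card _) (leq_imset_card Y _).
apply/subsetP => c; rewrite !inE negbK => /andP[/imsetP[w wv E] nX].
apply/imsetP; exists w => //; rewrite inE wv /=.
by apply: contra nX => /eqP E'; apply/imsetP; exists w; rewrite // E E'.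
Qed.

Lemma color_mismatch_le1 X Y v : color_mismatch X Y v <= 1.
Proof.
have <- : \sum_a \sum_b color_coupling X Y v a b = 1.
  under eq_bigr => a _ do rewrite color_coupling_suml.
  by rewrite sum_uniform_on // available_gt0.
do 2 (apply: ler_sum => ? _).
by rewrite ler_piMr ?color_coupling_ge0 // lern1 leq_b1.
Qed.

Lemma color_mismatch_le X Y v : color_mismatch X Y v <=
  (\sum_(w | e v w) (X w != Y w)%:R) / #|available e Y v|%:R.
Proof.
have -> : \sum_(w | e v w) (X w != Y w)%:R =
    #|[set w in neighbors e v | X w != Y w]|%:R :> R.
  rewrite -sum1_card natr_sum big_mkcond [RHS]big_mkcond /=.
  by apply: eq_bigr => w _; rewrite !inE; case: (e v w); case: (X w != Y w).
apply: le_trans (maximal_coupling_neq _ _ _ _) _; try exact: uniform_on_ge0.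
- by rewrite sum_uniform_on // available_gt0.
- by rewrite sum_uniform_on // available_gt0.
apply: overlap_uniform; rewrite ?available_gt0 ?card_available_diff //.
rewrite (_ : [set w in _ | _] = [set w in neighbors e v | Y w != X w]).
  exact: card_available_diff.
by apply/setP => w; rewrite !inE eq_sym.
Qed.

Definition starved (tau : R) Y : bool := [exists v, #|available e Y v|%:R < tau].

Lemma coupled_glauber_contract (c0 tau : R) X Y :
  0 <= c0 <= 1 -> D%:R <= (1 - c0) * tau ->
  \sum_X' \sum_Y' coupled_glauber X Y X' Y' * hamming X' Y' <=
  (1 - c0 / n%:R) * hamming X Y + (starved tau Y)%:R.
Proof.
move=> /andP[c00 c01] htau; rewrite coupled_glauber_hamming.
have n0 : 0 < n%:R :> R by rewrite ltr0n.
have H0 : 0 <= hamming X Y by apply: sumr_ge0 => w _; apply: ler0n.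
(* In the starved case the average mismatch is bounded by 1, which the additive term absorbs. *)
case: (boolP (starved tau Y)) => [_|ns] /=.
  have h : n%:R^-1 * (\sum_v color_mismatch X Y v) <= 1.
    rewrite -[leRHS](average_const hV) ler_wpM2l ?invr_ge0 ?ler0n //.
    by apply: ler_sum => v _; apply: color_mismatch_le1.
  have : 0 <= (1 - c0) * (n%:R^-1 * hamming X Y).
    by rewrite mulr_ge0 ?mulr_ge0 ?invr_ge0 ?ler0n // subr_ge0.
  by lra.
have good v : D%:R <= (1 - c0) * #|available e Y v|%:R.
  apply: le_trans htau _; rewrite ler_wpM2l ?subr_ge0 //.
  by move: ns => /existsPn/(_ v); rewrite -leNgt.
suff : \sum_v color_mismatch X Y v <= (1 - c0) * hamming X Y.
  move=> h; have := ler_wpM2l (ltW (_ : 0 < n%:R^-1)) h.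
  by rewrite invr_gt0 => /(_ n0); lra.
apply: (@le_trans _ _ (\sum_v \sum_(w | e v w) (X w != Y w)%:R * ((1 - c0) / D%:R))).
  apply: ler_sum => v _; apply: le_trans (color_mismatch_le _ _ _) _.
  rewrite mulr_suml; apply: ler_sum => w evw; rewrite ler_wpM2l ?ler0n //.
  have D0 : 0 < D%:R :> R.
    rewrite ltr0n; apply: leq_trans (leq_bigmax v).
    by apply/card_gt0P; exists w; rewrite inE.
  have A0 : 0 < #|available e Y v|%:R :> R by rewrite ltr0n available_gt0.
  by rewrite ler_pdivlMr // mulrC ler_pdivrMr.
(* Double counting: a disagreement at [w] is charged by at most [D] neighbors, each time with weight
   (1 - c0)/D. *)
rewrite (exchange_big_dep xpredT) //= mulr_sumr; apply: ler_sum => w _.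
rewrite -mulr_sumr mulrC ler_wpM2r ?ler0n //.
rewrite sumr_const (eq_card (B := mem (neighbors e w))); last first.
  by move=> v; rewrite [in RHS]inE; case: hsimple => ->.
have dw : (#|neighbors e w| <= D)%N by apply: (leq_bigmax w).
rewrite -[leLHS]mulr_natl.
have [D0|D0] := posnP D.
  by move: dw; rewrite D0 leqn0 => /eqP ->; rewrite mul0r subr_ge0.
have DR : 0 < D%:R :> R by rewrite ltr0n.
rewrite mulrCA ler_piMr ?subr_ge0 // ler_pdivrMr // mul1r ler_nat //.
Qed.

Fixpoint coupled_law X0 t : coloring V k -> coloring V k -> R :=
  match t with
  | 0%N => fun X Y => (X == X0)%:R * pi Y
  | s.+1 => fun X' Y' =>
      \sum_X \sum_Y coupled_law X0 s X Y * coupled_glauber X Y X' Y'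
  end.

Lemma coupled_law_ge0 X0 t X Y : 0 <= coupled_law X0 t X Y.
Proof.
elim: t X Y => [|t IH] X Y /=.
  by rewrite mulr_ge0 ?ler0n ?uniform_proper_ge0.
by do 2 (apply: sumr_ge0 => ? _); rewrite mulr_ge0 ?coupled_glauber_ge0.
Qed.

Lemma coupled_law_suml X0 t X : \sum_Y coupled_law X0 t X Y = glauber_law e R X0 t X.
Proof.
elim: t X => [|t IH] X' /=.
  by rewrite -mulr_sumr (sum_uniform_proper _ hdeg hsimple X0) mulr1.
rewrite exchange_big /=; apply: eq_bigr => X _.
rewrite -IH mulr_suml exchange_big /=; apply: eq_bigr => Y _.
by rewrite -mulr_sumr coupled_glauber_suml.
Qed.

Lemma coupled_law_sumr X0 t Y : \sum_X coupled_law X0 t X Y = pi Y.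
Proof.
elim: t Y => [|t IH] Y' /=.
  by rewrite -mulr_suml sum_eq1 mul1r.
rewrite exchange_big /=; under eq_bigr => X _ do rewrite exchange_big /=.
rewrite exchange_big /= -(glauber_invariant R hdeg hsimple hV).
apply: eq_bigr => Y _; rewrite -IH mulr_suml; apply: eq_bigr => X _.
by rewrite -mulr_sumr coupled_glauber_sumr.
Qed.

(** The coupling inequality, combined with the fact that distinct colorings are at Hamming distance
    at least 1. *)
Lemma tv_dist_le_hamming X0 t :
  tv_dist (glauber_law e R X0 t) pi <=
  \sum_X \sum_Y coupled_law X0 t X Y * hamming X Y.
Proof.
set J := coupled_law X0 t.
have J0 X Y : 0 <= J X Y := coupled_law_ge0 X0 t X Y.
have neq_le_hamming X Y : (X != Y)%:R <= hamming X Y.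
  have H0 : 0 <= hamming X Y by apply: sumr_ge0 => w _; apply: ler0n.
  case: (boolP [exists w, X w != Y w]) => [/existsP[w ne]|/existsPn eqXY].
    apply: (@le_trans _ _ 1); first by rewrite lern1 leq_b1.
    rewrite /hamming (bigD1 w) //= ne lerDl.
    by apply: sumr_ge0 => u _; apply: ler0n.
  suff -> : X == Y by [].
  by apply/eqP/ffunP => w; have := eqXY w; rewrite negbK => /eqP.
apply: (@le_trans _ _ (\sum_X \sum_Y J X Y * (X != Y)%:R)); last first.
  by do 2 (apply: ler_sum => ? _); rewrite ler_wpM2l.
rewrite /tv_dist ler_pdivrMl ?ltr0n // mulr_natl mulr2n.
rewrite [X in _ <= _ + X]exchange_big /= -big_split /=.
apply: ler_sum => Z _; rewrite -coupled_law_suml -(coupled_law_sumr X0 t) -/J.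
rewrite -sumrB -big_split /=.
apply: le_trans (ler_norm_sum _ _ _) _; apply: ler_sum => W _.
rewrite [W == Z]eq_sym; case: eqP => [->|_]; first by rewrite subrr normr0 !mulr0 addr0.
by rewrite !mulr1; apply: le_trans (ler_normB _ _) _; rewrite !ger0_norm.
Qed.

(** The expected distance h satisfies h' <= (1 - c0/n) h + P(starved), and [q] dominates the fixed
    point of this recursion. P(starved) does not grow with time because the second copy is
    stationary throughout. *)
Lemma coupled_law_hamming (c0 tau q : R) X0 t :
  0 <= c0 <= 1 -> D%:R <= (1 - c0) * tau -> 0 <= q ->
  \sum_Y pi Y * (starved tau Y)%:R <= c0 / n%:R * q ->
  \sum_X \sum_Y coupled_law X0 t X Y * hamming X Y <=
  n%:R * (1 - c0 / n%:R) ^+ t + q.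
Proof.
move=> c0P htau q0 hq; have /andP[c00 c01] := c0P.
have n1 : 1 <= n%:R :> R by rewrite ler1n.
have r0 : 0 <= 1 - c0 / n%:R.
  by rewrite subr_ge0 ler_pdivrMr ?mul1r; lra.
have tot s : \sum_X \sum_Y coupled_law X0 s X Y = 1.
  rewrite -(glauber_law_sum1 R hdeg hV X0 s).
  by apply: eq_bigr => X _; apply: coupled_law_suml.
elim: t => [|t IH].
  rewrite expr0 mulr1; apply: ler_wpDr => //.
  have -> : n%:R = \sum_X \sum_Y coupled_law X0 0 X Y * n%:R :> R.
    under eq_bigr => X _ do rewrite -mulr_suml.
    by rewrite -mulr_suml tot mul1r.
  apply: ler_sum => X _; apply: ler_sum => Y _.
  rewrite ler_wpM2l ?coupled_law_ge0 //.
  rewrite /hamming -sum1_card natr_sum; apply: ler_sum => w _.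
  by rewrite lern1 leq_b1.
set J := coupled_law X0 t.
have -> : \sum_X \sum_Y coupled_law X0 t.+1 X Y * hamming X Y =
    \sum_X \sum_Y J X Y *
      (\sum_X' \sum_Y' coupled_glauber X Y X' Y' * hamming X' Y').
  rewrite /=.
  under eq_bigr => X' _ do under eq_bigr => Y' _ do rewrite mulr_suml.
  under eq_bigr => X' _ do rewrite exchange_big /=.
  rewrite exchange_big /=; apply: eq_bigr => X _.
  under eq_bigr => X' _ do under eq_bigr => Y' _ do rewrite mulr_suml.
  under eq_bigr => X' _ do rewrite exchange_big /=.
  rewrite exchange_big /=; apply: eq_bigr => Y _.
  rewrite mulr_sumr; apply: eq_bigr => X' _.
  by rewrite mulr_sumr; apply: eq_bigr => Y' _; rewrite mulrA.
apply: (@le_trans _ _ (\sum_X \sum_Y (J X Y * hamming X Y * (1 - c0 / n%:R) +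
    J X Y * (starved tau Y)%:R))).
  apply: ler_sum => X _; apply: ler_sum => Y _.
  rewrite -mulrA -mulrDr ler_wpM2l ?coupled_law_ge0 // [hamming X Y * _]mulrC.
  exact: coupled_glauber_contract.
under eq_bigr => X _ do rewrite big_split /= -mulr_suml.
rewrite big_split /= -mulr_suml [X in _ + X]exchange_big /=.
under [X in _ + X]eq_bigr => Y _ do rewrite -mulr_suml coupled_law_sumr.
have := ler_wpM2r r0 IH; rewrite exprSr; lra.
Qed.

End CoupledDynamics.

(** * Mixing time *)

Lemma expr_1B_le_expR (R : realType) (x : R) (t : nat) :
  x <= 1 -> (1 - x) ^+ t <= expR (- (x * t%:R)).
Proof.
move=> x1; rewrite -mulNr expRM_natr lerXn2r ?nnegrE ?subr_ge0 ?expR_ge0 //.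
exact: expR_ge1Dx.
Qed.

Lemma starved_prob (R : realType) (V : finType) (e : rel V) (k : nat)
    (tau p : R) :
  (forall v, \sum_(Y : coloring V k) uniform_proper e R Y *
     (#|available e Y v|%:R < tau :> R)%:R <= p) ->
  \sum_(Y : coloring V k) uniform_proper e R Y * (starved e tau Y)%:R <=
  #|V|%:R * p.
Proof.
move=> H; apply: (@le_trans _ _ (\sum_(v : V) p)); last first.
  by rewrite sumr_const mulr_natl.
apply: le_trans (ler_sum _ (fun v _ => H v)).
rewrite exchange_big /=; apply: ler_sum => Y _.
rewrite -mulr_sumr ler_wpM2l ?uniform_proper_ge0 //.
case: (boolP (starved e tau Y)) => [/existsP[v hv]|_]; last first.
  by apply: sumr_ge0 => v _; apply: ler0n.
by rewrite (bigD1 v) //= hv lerDl; apply: sumr_ge0 => w _; apply: ler0n.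
Qed.

(** The time condition is on [t.+1] so that it survives the rounding down in [T %/ j]. The bound 1/8
    is 1/16 from the contraction plus 1/16 from starved colorings. *)
Lemma tv_dist_short (R : realType) (alpha zeta : R) (V : finType) (e : rel V)
    (k : nat) (X0 : coloring V k) (t : nat) :
  alpha = expR (1 / alpha) -> 0 < zeta < 1 ->
  simple_graph e -> triangle_free e -> (0 < #|V|)%N ->
  ((max_degree e).+1 < k)%N ->
  (1 + zeta) * alpha * (max_degree e)%:R <= k%:R ->
  288 * ln (96 * #|V|%:R ^+ 3 / zeta) <= zeta ^+ 2 * k%:R ->
  6 * #|V|%:R * ln (32 * #|V|%:R) <= zeta * t.+1%:R ->
  tv_dist (glauber_law e R X0 t) (uniform_proper e R) <= 8^-1.
Proof.
move=> halpha hz hsimple htri hV hdeg hk1 hk2 ht.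
have /andP[z0 z1] := hz.
have n1 : 1 <= #|V|%:R :> R by rewrite ler1n.
set n : R := #|V|%:R in n1 hk2 ht *.
have n0 : 0 < n by lra.
have n3 : 1 <= n ^+ 3 by rewrite exprn_ege1.
set B := 96 * n ^+ 3 / zeta in hk2.
have B96 : 96 <= B by rewrite /B ler_pdivlMr //; nra.
have B0 : 0 < B by lra.
have L1 : 1 <= ln B.
  rewrite -ler_expR lnK ?posrE //; apply: le_trans (@expR1_le4 R) _; lra.
have D0 : 0 <= (max_degree e)%:R :> R by apply: ler0n.
have dev := large_deviation_exponent halpha hz D0 hk1 hk2 L1.
set tau := (1 + zeta / 5) * (max_degree e)%:R in dev.
have prob : \sum_(Y : coloring V k) uniform_proper e R Y * (starved e tau Y)%:R
    <= n * B^-1.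
  apply: starved_prob => v.
  apply: (le_trans (few_available_prob hdeg hsimple htri v (lam := zeta / 6) tau X0 _)).
    by apply/andP; split; lra.
  rewrite [leRHS](_ : _ = expR (- ln B)); last by rewrite expRN lnK.
  by rewrite ler_expR.
have h := @coupled_law_hamming V e k R (ltnW hdeg) hsimple hV (zeta / 6) tau 16^-1 X0 t.
apply: le_trans (tv_dist_le_hamming R (ltnW hdeg) hsimple hV _ _) _.
apply: le_trans (h _ _ _ _) _.
- by apply/andP; split; lra.
(* (1 - z/6)(1 + z/5) = 1 + z(1 - z)/30 >= 1 for z = [zeta]. *)
- by rewrite /tau mulrA ler_peMl //; nra.
- by lra.
- apply: le_trans prob _; rewrite -/n.
  (* The constant 96 n^3 is matched to this: the union bound gives zeta/(96 n^2), and the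
     contraction rate zeta/(6n) times 1/16 is zeta/(96 n). *)
  have -> : n * B^-1 = zeta / 96 * (n ^+ 2)^-1.
    by rewrite /B; field; rewrite !gt_eqF.
  have : (n ^+ 2)^-1 <= n^-1 by rewrite lef_pV2 ?posrE ?exprn_gt0 // ler_eXnr.
  by move=> /(ler_wpM2l (_ : 0 <= zeta / 96)) => /(_ _); lra.
rewrite -/n; set x := zeta / 6 / n.
have x6 : x <= 6^-1 by rewrite /x ler_pdivrMr //; nra.
(* Passing from [t.+1] to [t] costs x <= 1/6 in the exponent, that is, a factor exp(1/6) <= 2. *)
have xt : ln (32 * n) - 6^-1 <= x * t%:R.
  have : ln (32 * n) <= x * t.+1%:R.
    rewrite /x -(ler_pM2l (_ : 0 < 6 * n)); last by rewrite mulr_gt0.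
    apply: le_trans ht _; rewrite le_eqVlt; apply/orP; left; apply/eqP; field.
    by rewrite gt_eqF.
  by rewrite -natr1; lra.
have E : (1 - x) ^+ t <= 2 / (32 * n).
  apply: le_trans (expr_1B_le_expR _ _) _; first by lra.
  apply: (@le_trans _ _ (expR (6^-1 - ln (32 * n)))); first by rewrite ler_expR; lra.
  have n32 : 0 < 32 * n by lra.
  rewrite expRB lnK ?posrE // ler_pM2r ?invr_gt0 //.
  by apply: le_trans (expR_le_quadratic _) _; [apply/andP; split|]; lra.
have : n * (1 - x) ^+ t <= 16^-1.
  apply: le_trans (ler_wpM2l (ltW n0) E) _.
  by rewrite le_eqVlt; apply/orP; left; apply/eqP; field; rewrite gt_eqF.
lra.
Qed.

Theorem theorem1p4 (R : realType) (alpha : R) (halpha : alpha = expR (1 / alpha))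
  (zeta : R) (hzeta : 0 < zeta < 1)
  (V : finType) (e : rel V) (hsimple : simple_graph e) (htri : triangle_free e)
  (n : nat) (hn : #|V| = n) (hn0 : (0 < n)%N)
  (Delta : nat) (hDelta : max_degree e = Delta)
  (k : nat)
  (hk : Num.max ((1 + zeta) * alpha * Delta%:R)
                (288 * ln (96 * n%:R ^+ 3 / zeta) / zeta ^+ 2) <= k%:R)
  (X0 : coloring V k) :
  forall (delta : R), 0 < delta ->
  forall (T : nat),
    6 * n%:R * (Num.ceil (ln (32 * n%:R : R)))%:~R
      * (Num.ceil (ln (1 / delta)))%:~R / zeta <= T%:R :> R ->
  tv_dist (glauber_law e R X0 T) (uniform_proper e R) <= delta.
Proof.
move=> delta delta0 T; have /andP[z0 z1] := hzeta.
move: hk; rewrite ge_max => /andP[hk1].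
rewrite ler_pdivrMr ?exprn_gt0 // [leRHS]mulrC => hk2 hT.
move: hn0 hk1 hk2 hT; rewrite -hn -hDelta => hV hk1 hk2 hT.
have n1 : 1 <= #|V|%:R :> R by rewrite ler1n.
have n3 : 1 <= #|V|%:R ^+ 3 :> R by rewrite exprn_ege1.
have hL : 1 <= ln (96 * #|V|%:R ^+ 3 / zeta).
  have hB : 96 <= 96 * #|V|%:R ^+ 3 / zeta by rewrite ler_pdivlMr //; nra.
  rewrite -ler_expR lnK ?posrE; last by lra.
  by apply: le_trans (@expR1_le4 R) _; lra.
have /andP[alo _] := alpha_itv halpha.
have hdeg : ((max_degree e).+1 < k)%N.
  have D0 : 0 <= (max_degree e)%:R :> R := ler0n _ _.
  have k0 : 0 <= k%:R :> R := ler0n _ _.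
  have zk : zeta ^+ 2 * k%:R <= k%:R by rewrite ler_piMl // exprn_ile1 // ltW.
  have Dk : 8 / 5 * (max_degree e)%:R <= k%:R :> R.
    by apply: le_trans hk1; rewrite ler_wpM2r //; nra.
  rewrite -(ltr_nat R) -natr1; lra.
(* For [delta] >= 1 the ceiling of ln(1/delta) is not positive, so the hypothesis on [T] says
   nothing; the trivial bound suffices. *)
have delta1 : 1 <= delta -> tv_dist (glauber_law e R X0 T) (uniform_proper e R) <= delta.
  exact: le_trans (tv_dist_le1 R (ltnW hdeg) hsimple hV _ _).
have [/delta1//|dlt1] := leP 1 delta.
have ld0 : 0 < ln (1 / delta) by rewrite ln_gt0 // div1r invf_gt1.
have := ceil_ge (ln (1 / delta)); have := ld0; rewrite -ceil_gt0.
case: (Num.ceil (ln (1 / delta))) hT => // j hT j0 hj.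
rewrite -[(Posz j)%:~R]/(j%:R) in hT hj.
have j0' : (0 < j)%N by [].
have jR : 0 < j%:R :> R by rewrite ltr0n.
(* Split the run into [j] blocks of [T %/ j] steps, with [j] the ceiling of ln(1/delta). *)
rewrite (divn_eq T j) addnC mulnC.
have short (Z : coloring V k) :
    tv_dist (glauber_law e R Z (T %/ j)) (uniform_proper e R) <= 8^-1.
  apply: (tv_dist_short _ halpha hzeta hsimple htri hV hdeg hk1 hk2).
  have Tj : T%:R <= j%:R * (T %/ j).+1%:R :> R.
    by rewrite -natrM ler_nat mulnC ltnW // ltn_ceil.
  have h := le_trans hT Tj.
  rewrite ler_pdivrMr // [leLHS]mulrC -!mulrA ler_pM2l // in h.
  rewrite [leRHS]mulrC; apply: le_trans h; rewrite -!mulrA.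
  by rewrite !ler_pM2l //; [exact: ceil_ge | lra].
apply: le_trans (tv_dist_iter (ltnW hdeg) hsimple hV X0 (T %% j) j short) _.
(* Each block gains a factor 2/8 = 1/4 <= 1/e, so [j] blocks bring the distance below exp(-j) <=
   [delta]. *)
have h4 : 2 * 8^-1 <= expR (- 1) :> R.
  rewrite expRN (_ : 2 * 8^-1 = 4^-1); last by field.
  by rewrite lef_pV2 ?posrE ?expR_gt0 // expR1_le4.
apply: (@le_trans _ _ (expR (- 1) ^+ j)).
  by rewrite lerXn2r ?nnegrE ?expR_ge0 //; lra.
rewrite -expRM_natr mulN1r.
apply: (@le_trans _ _ (expR (- ln (1 / delta)))); first by rewrite ler_expR lerN2.
by rewrite expRN lnK ?posrE ?divr_gt0 // div1r invrK.
Qed.
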